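(* Let $k \ge 1$ be an integer, and let $G$ be a graph on $n$ vertices. If $\beta^k(G) \ge 1$, then $G$ contains at least $k-1$ pairwise edge-disjoint perfect matchings if $n$ is even, or $k-1$ pairwise edge-disjoint near-perfect matchings if $n$ is odd.
   Context: All graphs are finite and simple. For $S\subseteq V(G)$, $\Lambda^k_G(S)$ is the set of vertices with at least $k$ neighbors in $S$, and $\beta^k(G)=\min\{|\Lambda^k_G(S)|/|S| : S\subseteq V(G),\ |S|\ge k,\ \Lambda^k_G(S)\ne V(G)\}$, with $\beta^k(G)=0$ if $|V(G)|<k$. A near-perfect matching of a graph of odd order is a matching covering all vertices but one. *)

(* Defs.v *)
From mathcomp Require Import all_boot all_order all_algebra.

Set Implicit Arguments.
Unset Strict Implicit.
Unset Printing Implicit Defensive.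

Import Order.TTheory GRing.Theory Num.Theory.

Record sgraph := SGraph {
  vertex :> finType;
  adj : rel vertex;
  adj_sym : symmetric adj;
  adj_irrefl : irreflexive adj }.

Section Graphs.
Variable G : sgraph.

Definition edges : {set {set G}} :=
  [set [set p.1; p.2] | p : G * G & adj p.1 p.2].

Definition Lambda (k : nat) (S : {set G}) : {set G} :=
  [set v | k <= #|[set u in S | adj v u]|].

Definition admissible (k : nat) (S : {set G}) : bool :=
  (k <= #|S|) && (Lambda k S != [set: G]).

Definition ratio (k : nat) (S : {set G}) : rat :=
  (#|Lambda k S|%:R / #|S|%:R)%R.

(* For 1 <= k <= #|G|, any S with #|S| = k is admissible (lemma admissible_card
   below), so the second branch is a genuine minimum; its value 0 on [None] is
   only reached when k = 0. *)
Definition beta (k : nat) : rat :=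
  if #|G| < k then 0%R
  else if [pick S | admissible k S] is Some S0
       then ratio k [arg min_(S < S0 | admissible k S) ratio k S]%O
       else 0%R.

Definition is_matching (M : {set {set G}}) : bool :=
  (M \subset edges) && trivIset M.

Definition perfect_matching (M : {set {set G}}) : bool :=
  is_matching M && (cover M == [set: G]).

Definition near_perfect_matching (M : {set {set G}}) : bool :=
  is_matching M && (#|~: cover M| == 1).

Definition edge_disjoint (F : {set {set {set G}}}) : Prop :=
  {in F &, forall M N : {set {set G}}, M != N -> [disjoint M & N]}.

Lemma admissible_card (k : nat) (S : {set G}) :
  0 < k -> #|S| = k -> admissible k S.
Proof.
move=> k0 cS; rewrite /admissible cS leqnn /=; apply/eqP => LT.
have /card_gt0P[x xS] : 0 < #|S| by rewrite cS.
have: x \in Lambda k S by rewrite LT inE.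
rewrite inE -cS leqNgt => /negP; apply; apply: proper_card.
apply/properP; split; first by apply/subsetP => u; rewrite inE => /andP[].
by exists x => //; rewrite inE adj_irrefl andbF.
Qed.

Lemma beta_lt (k : nat) : #|G| < k -> beta k = 0%R.
Proof. by rewrite /beta => ->. Qed.

Lemma beta_min (k : nat) : 0 < k -> k <= #|G| ->
  (exists2 S, admissible k S & beta k = ratio k S) /\
  (forall S, admissible k S -> (beta k <= ratio k S)%R).
Proof.
move=> k0 kG; rewrite /beta ltnNge kG /=.
case: pickP => [S0 aS0|noS].
  by case: arg_minP => //= S aS minS; split => //; exists S.
have [S _ cS] : exists2 S : {set G}, S \subset [set: G] & #|S| = k.
  have: 0 < #|[set A : {set G} | A \subset [set: G] & #|A| == k]|.
    by rewrite cards_draws cardsT bin_gt0.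
  by case/card_gt0P => S; rewrite inE => /andP[sS /eqP cS]; exists S.
by have := noS S; rewrite admissible_card.
Qed.

End Graphs.

(* Main.v *)
Require Import Defs.
From mathcomp Require Import all_boot all_order all_algebra.
From mathcomp Require Import zify.

Set Implicit Arguments.
Unset Strict Implicit.
Unset Printing Implicit Defensive.

(** Matchings are removed greedily.  After removing [j <= k - 2] of them, every
    vertex with [k] neighbours in [S] in [G] keeps two in the remaining graph
    [H].  If [H] has no matching missing at most one vertex, Gallai's argument
    yields a set [T] such that [H - T] splits into at least [|T| + 2] parts with
    no edge between them.  A set [S] meeting a part in one vertex gives no
    vertex of that part two neighbours in [S], so sets [S] built from one
    vertex per part and some entire parts have too few vertices with [k]
    neighbours in [S].  For [|S| = k] one uses in addition that no vertex of [S]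
    has [k] neighbours in [S]; this also gives [|V| >= 2k]. *)

(** * Involutions: parity of fixed points, and the orbit generated by two of them *)

Section Involutions.
Variable V : finType.
Implicit Types f g : V -> V.

Definition fixpts f : {set V} := [set x | f x == x].

(** [f] swaps the points it moves up in the enumeration with those it moves down, so the moved
    points are even in number. *)
Lemma odd_card_fixpts f : involutive f -> odd #|fixpts f| = odd #|V|.
Proof.
move=> ff.
pose up := [set x | enum_rank x < enum_rank (f x)].
pose dn := [set x | enum_rank (f x) < enum_rank x].
have fI : injective f := inv_inj ff.
have cdn : #|dn| = #|up|.
  rewrite -(card_imset _ fI); apply: eq_card => x; apply/imsetP/idP.
    by move=> [y]; rewrite !inE => yd ->; rewrite ff.
  by rewrite inE => xu; exists (f x); rewrite ?inE ff.
have cC : #|~: fixpts f| = #|up| + #|dn|.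
  rewrite -cardsUI (_ : up :&: dn = set0) ?cards0 ?addn0.
    apply: eq_card => x; rewrite !inE -neq_ltn (inj_eq val_inj).
    by rewrite (inj_eq enum_rank_inj) eq_sym.
  by apply/setP => x; rewrite !inE; case: ltngtP.
by rewrite -(cardsC (fixpts f)) cC cdn oddD addnn odd_double addbF.
Qed.

Section TwoInvolutions.
Variables (f g : V -> V) (v : V).
Hypotheses (ff : involutive f) (gg : involutive g) (gv : g v = v).

(* [f] and [g] generate a dihedral action; as [g] fixes [v], the orbit of [v]
   under the rotation [f \o g] is already the full dihedral orbit. *)
Let h := f \o g.
Definition dihedral_orbit : {set V} := [set x | fconnect h v x].

Let hI : injective h.
Proof. exact: inj_comp (inv_inj ff) (inv_inj gg). Qed.

(** [g] conjugates [h] to its inverse and fixes [v]. *)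
Let iter_reflect i : iter i h (g (iter i h v)) = v.
Proof.
elim: i => [|i IH]; first by rewrite /= gv.
by rewrite iterSr {2}/h /= -/h gg ff -[in RHS]IH.
Qed.

Lemma dihedral_orbit_base : v \in dihedral_orbit.
Proof. by rewrite inE connect0. Qed.

Let orbit_g x : x \in dihedral_orbit -> g x \in dihedral_orbit.
Proof.
rewrite !inE => /iter_findex <-; rewrite fconnect_sym //.
by rewrite -[X in fconnect _ _ X](iter_reflect (findex h v x)) fconnect_iter.
Qed.

Lemma mem_dihedral_orbit_r x : (g x \in dihedral_orbit) = (x \in dihedral_orbit).
Proof. by apply/idP/idP => /orbit_g //; rewrite gg. Qed.

Lemma mem_dihedral_orbit_l x : (f x \in dihedral_orbit) = (x \in dihedral_orbit).
Proof.
rewrite -[RHS]mem_dihedral_orbit_r -{1}(gg x) !inE.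
by rewrite -(same_fconnect1_r hI).
Qed.

(* If [f] fixes [h^i v] then [h^(2i-1) v = v]: the orbit has odd length and
   [i] is determined modulo that length. *)
Lemma dihedral_orbit_fix_uniq x y :
  x \in dihedral_orbit -> y \in dihedral_orbit -> f x = x -> f y = y -> x = y.
Proof.
have fixE i : f (iter i h v) = iter i h v -> h v = iter (i + i) h v.
  move=> fi; have e : h (g (iter i h v)) = iter i h v by rewrite /h /= gg.
  by rewrite iterD -[in RHS]e -iterSr iterS iter_reflect.
have hiI n : injective (iter n h).
  by elim: n => //= n IH a b /hI /IH.
have itermul a b w : iter a h w = w -> iter (b * a) h w = w.
  by move=> aw; elim: b => //= b IH; rewrite mulSn iterD IH.
rewrite !inE => /iter_findex <- /iter_findex <-.
move: (findex h v x) (findex h v y) => i j {x y}.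
wlog le_ij : i j / i <= j.
  by case/orP: (leq_total i j) => ij W fi fj; [|symmetry]; apply: W.
move=> /fixE ei /fixE ej; rewrite -(subnKC le_ij) iterD.
congr (iter _ _ _); set d := j - i.
have d2 : iter (d + d) h v = v.
  apply: (hiI (i + i)); rewrite -iterD -ei ej; congr (iter _ _ _).
  by rewrite /d; lia.
(* The odd period is [2i - 1]; for [i = 0] the equation [ei] gives period 1. *)
have [c ac] : exists c, iter (c + c).+1 h v = v.
  move: ei; rewrite addnn -mul2n; case: (i) => [|i'] ei; first by exists 0.
  exists i'; apply: hI; rewrite ei.
  by rewrite -[LHS]/(iter (i' + i').+2 h v) (_ : 2 * _ = (i' + i').+2) //; lia.
(* [d] times the odd period is [d] plus [c] times the period [2d], so [h^d] fixes [v]. *)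
have := itermul _ d _ ac.
rewrite (_ : d * _ = d + c * (d + d)); last by lia.
by rewrite iterD (itermul _ c _ d2).
Qed.

End TwoInvolutions.
End Involutions.

(** * Maximum matchings and Gallai's barrier *)

Section GallaiBarrier.
Variables (V : finType) (adj : rel V).
Hypothesis adj_sym : symmetric adj.
Implicit Types (T S : {set V}) (f g : {ffun V -> V}).

(* A matching of the graph minus [T], encoded as the involution exchanging the
   ends of each edge; the vertices left uncovered are its fixed points. *)
Definition matching_off T f : bool :=
  [forall x, (f (f x) == x) &&
     ((f x != x) ==> [&& adj x (f x), x \notin T & f x \notin T])].

Lemma matching_offP T f :
  reflect (involutive f /\
           forall x, f x != x -> [/\ adj x (f x), x \notin T & f x \notin T])
          (matching_off T f).
Proof.
apply: (iffP forallP) => [H|[ff H] x]; last first.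
  by rewrite ff eqxx /=; apply/implyP => /H [-> -> ->].
split=> x; first by case/andP: (H x) => /eqP.
by move=> fx; case/andP: (H x) => _ /implyP/(_ fx)/and3P.
Qed.

Lemma matching_off_id T : matching_off T [ffun x => x].
Proof.
by apply/matching_offP; split=> x; rewrite !ffunE ?eqxx.
Qed.

Lemma matching_offS T T' f : T \subset T' -> matching_off T' f -> matching_off T f.
Proof.
move=> /subsetP sT /matching_offP[ff H]; apply/matching_offP; split=> // x /H.
by case=> -> xT fT; split=> //; [apply: contra xT | apply: contra fT]; apply: sT.
Qed.

Definition opt_matching T : {ffun V -> V} :=
  [arg min_(f < [ffun x => x] | matching_off T f) #|fixpts f|].

(** The vertices of [T] are always fixed, so they are counted too: this is [#|T|] plus the usual
    deficiency of the graph minus [T]. *)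
Definition deficit T := #|fixpts (opt_matching T)|.

Lemma opt_matchingP T : matching_off T (opt_matching T).
Proof. by rewrite /opt_matching; case: arg_minnP => //; apply: matching_off_id. Qed.

Lemma deficit_min T f : matching_off T f -> deficit T <= #|fixpts f|.
Proof.
rewrite /deficit /opt_matching.
by case: arg_minnP => [|g _]; [exact: matching_off_id | apply].
Qed.

Definition optimal T f := matching_off T f && (#|fixpts f| == deficit T).

Lemma optimal_opt T : optimal T (opt_matching T).
Proof. by rewrite /optimal opt_matchingP eqxx. Qed.

Lemma matching_off_fix T f x : matching_off T f -> x \in T -> f x = x.
Proof.
move=> /matching_offP[_ H] xT; apply/eqP/negPn/negP => /H[_].
by rewrite xT.
Qed.

Section Switch.
Variables (T O : {set V}) (f g : {ffun V -> V}).
Hypotheses (fO : forall x, (f x \in O) = (x \in O))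
           (gO : forall x, (g x \in O) = (x \in O)).
Definition switch : {ffun V -> V} := [ffun x => if x \in O then g x else f x].

Lemma switch_matching :
  matching_off T f -> matching_off T g -> matching_off T switch.
Proof.
move=> /matching_offP[ff Hf] /matching_offP[gg Hg]; apply/matching_offP; split.
  by move=> x; rewrite !ffunE; case xO: (x \in O); rewrite ?gO ?fO xO ?gg ?ff.
by move=> x; rewrite !ffunE; case: ifP => _; [apply: Hg | apply: Hf].
Qed.

Lemma card_fixpts_switch :
  #|fixpts switch| = #|fixpts g :&: O| + #|fixpts f :\: O|.
Proof.
rewrite -(cardsID O); congr (_ + _); apply: eq_card => x; rewrite !inE ffunE;
  by case: (x \in O); rewrite ?andbF.
Qed.
End Switch.

(** Gallai's relation; the first disjunct makes it reflexive. *)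
Definition never_both_missed T x y : bool :=
  (x == y) || [forall f, optimal T f ==> ~~ ((f x == x) && (f y == y))].

Lemma never_both_missedP T x y :
  reflect (x = y \/ forall f, optimal T f -> f x = x -> f y = y -> False)
          (never_both_missed T x y).
Proof.
apply: (iffP orP) => [[/eqP ->|/forallP H]|[->|H]]; rewrite ?eqxx; auto.
  by right=> f /(implyP (H f)) /negP nf fx fy; apply: nf; rewrite fx fy !eqxx.
right; apply/forallP => f; apply/implyP => of_; apply/negP => /andP[/eqP a /eqP b].
exact: H of_ a b.
Qed.

Lemma never_both_missed_sym T : symmetric (never_both_missed T).
Proof.
move=> x y; rewrite /never_both_missed eq_sym; congr (_ || _).
by apply: eq_forallb => f; rewrite [X in ~~ X]andbC.
Qed.

(* Were [x] and [z] both missed by an optimal [f], switch [f] along the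
   alternating path from [y] given by an optimal [g] missing [y]: this frees
   [y] and covers at most one of [x], [z]. *)
Lemma never_both_missed_trans T x y z :
  (exists2 g, optimal T g & g y = y) ->
  never_both_missed T x y -> never_both_missed T y z -> never_both_missed T x z.
Proof.
move=> [g /andP[mg /eqP cg] gy].
move=> /never_both_missedP[-> //|xy] /never_both_missedP[<-|yz].
  by apply/never_both_missedP; right.
apply/never_both_missedP; case: (eqVneq x z) => [|nxz]; [by left | right].
move=> f /andP[mf /eqP cf] fx fz.
have [ff _] := matching_offP _ _ mf; have [gg _] := matching_offP _ _ mg.
pose O := dihedral_orbit f g y.
have fO w : (f w \in O) = (w \in O) by apply: mem_dihedral_orbit_l.
have gO w : (g w \in O) = (w \in O) by apply: mem_dihedral_orbit_r.
have le1 : #|fixpts f :&: O| <= 1.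
  apply/card_le1_eqP => a b /setIP[]; rewrite inE => /eqP fa aO /setIP[].
  by rewrite inE => /eqP fb bO; apply: (dihedral_orbit_fix_uniq ff gg gy bO aO fb fa).
(* The reverse exchange, [f] inside [O] and [g] outside, shows that [g] misses no more of [O] than
   [f] does; hence [switch O f g] is optimal. *)
have := deficit_min (switch_matching gO fO mg mf).
rewrite card_fixpts_switch -cg -{1}(cardsID O (fixpts g)) leq_add2r => gf.
have oS : optimal T (switch O f g).
  rewrite /optimal switch_matching //= eqn_leq deficit_min ?switch_matching // andbT.
  by rewrite card_fixpts_switch -cf -(cardsID O (fixpts f)) leq_add2r.
have Sy : switch O f g y = y by rewrite ffunE dihedral_orbit_base.
case xO: (x \in O); last by apply: (xy _ oS _ Sy); rewrite ffunE xO.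
case zO: (z \in O); last by apply: (yz _ oS Sy); rewrite ffunE zO.
by case/eqP: nxz; apply: (dihedral_orbit_fix_uniq ff gg gy xO zO fx fz).
Qed.

(** Otherwise the edge [xy] could be added to an optimal matching. *)
Lemma adj_never_both_missed T x y :
  x \notin T -> y \notin T -> adj x y -> never_both_missed T x y.
Proof.
move=> xT yT xy; apply/never_both_missedP.
case: (eqVneq x y) => [|nxy]; [by left | right].
move=> f /andP[mf /eqP cf] fx fy; have [ff Hf] := matching_offP _ _ mf.
pose g : {ffun V -> V} := [ffun w => if w == x then y else if w == y then x else f w].
have nyx : y != x by rewrite eq_sym.
have mg : matching_off T g.
  apply/matching_offP; split=> w; rewrite !ffunE.
    case: (eqVneq w x) => [->|wx]; first by rewrite (negPf nyx) eqxx.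
    case: (eqVneq w y) => [->|wy]; first by rewrite eqxx.
    by rewrite -{1}fx -{2}fy !(inj_eq (inv_inj ff)) (negPf wx) (negPf wy) ff.
  case: (eqVneq w x) => [-> //|wx].
  by case: (eqVneq w y) => [->|wy]; [rewrite adj_sym | apply: Hf].
have := deficit_min mg; rewrite -cf leqNgt => /negP; apply.
apply: proper_card; apply/properP; split; last first.
  by exists x; rewrite inE ?fx // ffunE eqxx.
apply/subsetP => w; rewrite !inE ffunE.
case: (eqVneq w x) => [->|wx]; first by rewrite (negPf nyx).
by case: (eqVneq w y) => [->|//]; rewrite (negPf nxy).
Qed.

(* Gallai's form of the Tutte-Berge barrier: [T] is maximal such that each of
   its deletions costs an edge of a maximum matching, and [c] picks a
   representative of each class of [never_both_missed T]. *)
Lemma gallai_barrier : exists T (c : V -> V),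
  [/\ forall x, x \notin T -> c x \notin T,
      forall x, x \notin T -> c (c x) = c x,
      forall x y, x \notin T -> y \notin T -> adj x y -> c x = c y &
      deficit set0 + #|T| <= #|c @: ~: T|].
Proof.
pose P T := deficit set0 + 2 * #|T| <= deficit T.
have P0 : P set0 by rewrite /P cards0 muln0 addn0.
case: (@arg_maxnP _ set0 P (fun T => #|T|) P0) => T PT maxT.
(* Maximality of [T] gives [deficit (y |: T) < deficit T + 2]; by parity the two deficits agree, so
   an optimal matching off [y |: T] is optimal for [T]. *)
have miss y : y \notin T -> exists2 g, optimal T g & g y = y.
  move=> yT; pose g := opt_matching (y |: T).
  have mg' : matching_off (y |: T) g := opt_matchingP _.
  have mg : matching_off T g by apply: matching_offS mg'; apply: subsetUr.
  exists g; last by apply: matching_off_fix mg' _; rewrite setU11.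
  have [gg _] := matching_offP _ _ mg.
  have [oo _] := matching_offP _ _ (opt_matchingP T).
  have eo : odd #|fixpts g| = odd (deficit T) by rewrite /deficit !odd_card_fixpts.
  have := deficit_min mg; rewrite /optimal mg /=.
  have : ~~ P (y |: T).
    by apply/negP => /maxT; rewrite cardsU1 yT add1n /= ltnn.
  move: PT; rewrite /P -ltnNge cardsU1 yT.
  rewrite -[deficit (y |: T)]/#|fixpts g|; lia.
pose e := never_both_missed T.
pose c x := odflt x [pick y | (y \notin T) && e x y].
have cP x : x \notin T -> c x \notin T /\ e x (c x).
  move=> xT; rewrite /c; case: pickP => [y /andP[]//|/(_ x)].
  by rewrite xT /e /never_both_missed eqxx.
have ecc x y : x \notin T -> y \notin T -> e x y -> c x = c y.
  move=> xT yT xy; have eq_xy z : ((z \notin T) && e x z) = ((z \notin T) && e y z).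
    congr (_ && _); apply/idP/idP => h.
      by apply: never_both_missed_trans h; [apply: miss | rewrite never_both_missed_sym].
    by apply: never_both_missed_trans xy h; apply: miss.
  rewrite /c (eq_pick eq_xy); case: pickP => // /(_ y).
  by rewrite yT /e /never_both_missed eqxx.
exists T, c; split.
- by move=> x /cP[].
- by move=> x xT; have [? ?] := cP x xT; symmetry; apply: ecc.
- by move=> x y xT yT /(adj_never_both_missed xT yT); apply: ecc.
set o := opt_matching T.
have sT : T \subset fixpts o.
  by apply/subsetP => x xT; rewrite inE (matching_off_fix (opt_matchingP T)).
have cR : #|fixpts o :\: T| = deficit T - #|T|.
  by rewrite cardsD (setIidPr sT).
(* Vertices missed by the same optimal matching lie in different classes, so there are at least
   [deficit T - #|T|] classes. *)
have inj : {in fixpts o :\: T &, injective c}.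
  move=> x y; rewrite !inE => /andP[xT /eqP ox] /andP[yT /eqP oy] cxy.
  have [cT xc] := cP x xT; have [_ yc] := cP y yT.
  have : e x y.
    apply: never_both_missed_trans xc _; first exact: miss.
    by rewrite cxy /e never_both_missed_sym.
  by case/never_both_missedP => // /(_ o (optimal_opt T) ox oy).
have : #|fixpts o :\: T| <= #|c @: ~: T|.
  by rewrite -(card_in_imset inj) subset_leq_card // imsetS // setDE subsetIr.
move: PT; rewrite cR /P; lia.
Qed.

End GallaiBarrier.

(** * Expansion forces a matching missing at most one vertex *)

Lemma intermediate_set (V : finType) (A B : {set V}) (k : nat) :
  A \subset B -> #|A| <= k <= #|B| ->
  exists S : {set V}, [/\ A \subset S, S \subset B & #|S| = k].
Proof.
move=> sAB /andP[Ak kB].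
have: 0 < #|[set D : {set V} | D \subset B :\: A & #|D| == k - #|A|]|.
  by rewrite cards_draws bin_gt0 cardsD (setIidPr sAB) leq_sub2r.
case/card_gt0P => D; rewrite inE subsetD => /andP[/andP[sDB dDA] /eqP cD].
exists (A :|: D); split; rewrite ?subsetUl // ?subUset ?sAB //.
have AD0 : A :&: D = set0 by apply/eqP; rewrite setI_eq0 disjoint_sym.
by rewrite cardsU AD0 cards0 cD; lia.
Qed.

Section Expansion.
Variables (V : finType) (adj : rel V) (k : nat).
Hypothesis adj_sym : symmetric adj.

Definition two_nbrs (S : {set V}) : {set V} :=
  [set v | 1 < #|[set u in S | adj v u]|].

Hypotheses (kV : k <= #|V|)
  (expand : forall S : {set V}, k <= #|S| -> two_nbrs S != [set: V] -> #|S| <= #|two_nbrs S|)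
  (expand_out : forall S : {set V}, #|S| = k -> k <= #|two_nbrs S :\: S|).

Let card_ge_2k : 2 * k <= #|V|.
Proof.
have [S [_ _ cS]] : exists S : {set V}, [/\ set0 \subset S, S \subset setT & #|S| = k].
  by apply: intermediate_set; rewrite ?sub0set // cards0 cardsT.
have := leq_trans (expand_out cS) (subset_leq_card (subsetDr _ _)).
by have := cardsC S; lia.
Qed.

(* Given a barrier [T] with transversal [X] of the classes outside it, a set
   [X :|: U] with [U] a union of classes reaches, outside [U], only [T].
   Comparing sizes for [U] empty, for [U] one class, and for a set of size
   exactly [k] between two such sets rules out [#|X| >= #|T| + 2]. *)
Lemma deficit_le1 : deficit adj set0 <= 1.
Proof.
apply: contraT; rewrite -ltnNge => d2.
have [T [c [cT cc cadj qT]]] := gallai_barrier adj_sym.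
have {d2}qT : #|T| + 2 <= #|c @: ~: T| by lia.
set X := c @: ~: T in qT.
pose cls y := [set x | (x \notin T) && (c x == c y)].
have XP u : u \in X -> u \notin T /\ c u = u.
  by case/imsetP => w; rewrite inE => wT ->; split; [apply: cT | apply: cc].
have cX y : y \notin T -> c y \in X by move=> yT; apply: imset_f; rewrite inE.
(* Neighbours of [v] outside [T] lie in its class, where [S] contains at most the representative
   [c v]. *)
have notL (S : {set V}) v : (forall u, u \in S -> u \notin T) -> v \notin T ->
    (forall u, u \in S -> c u = c v -> u \in X) -> v \notin two_nbrs S.
  move=> SW vT Sv; rewrite inE -leqNgt -(cards1 (c v)); apply: subset_leq_card.
  apply/subsetP => u; rewrite !inE => /andP[uS vu].
  have cuv : c u = c v by symmetry; apply: cadj => //; apply: SW.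
  by have [_ <-] := XP u (Sv u uS cuv); rewrite cuv.
have Xk : #|X| < k.
  rewrite ltnNge; apply/negP => kX.
  have LT : two_nbrs X \subset T.
    apply/subsetP => v; apply: contraLR => vT; apply: notL => // u; by case/XP.
  have [x xX] : exists x, x \in X by apply/card_gt0P; lia.
  have : two_nbrs X != setT.
    apply/eqP => LX; have [/negP[]] := XP x xX.
    by apply: (subsetP LT); rewrite LX inE.
  by move=> /(expand kX); have := subset_leq_card LT; lia.
(* [X] meets [cls y] only in [c y], so the union has [#|X| + #|cls y| - 1] elements, more than
   [T :|: cls y] can have. This is where the surplus 2 is used. *)
have XC y : y \notin T -> #|X :|: cls y| < k.
  move=> yT; rewrite ltnNge; apply/negP => kXC.
  have SW u : u \in X :|: cls y -> u \notin T.
    by rewrite in_setU inE => /orP[/XP[]|/andP[]].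
  have LT : two_nbrs (X :|: cls y) \subset T :|: cls y.
    apply/subsetP => v; apply: contraLR; rewrite in_setU negb_or => /andP[vT].
    rewrite inE vT /= => vy; apply: notL => // u; rewrite in_setU inE.
    by case/orP => // /andP[_ /eqP ->] yv; rewrite yv eqxx in vy.
  have XCy : X :&: cls y = [set c y].
    apply/setP => u; rewrite in_setI !inE; apply/idP/eqP => [|->].
      by case/and3P => /XP[_ cu] _ /eqP; rewrite cu.
    by rewrite cX // cT // cc //= eqxx.
  have : two_nbrs (X :|: cls y) != setT.
    have [z] : exists z, z \in X :\ c y.
      by apply/card_gt0P; have := cardsD1 (c y) X; rewrite cX //; lia.
    rewrite !inE => /andP[zy /XP[zT cz]]; apply/eqP => LX.
    have := subsetP LT z; rewrite LX in_setU !inE (negPf zT) cz (negPf zy) /=.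
    by move=> /(_ isT).
  move=> /(expand kXC); have := cardsUI X (cls y); rewrite XCy cards1.
  by have := subset_leq_card LT; have := (leq_card_setU T (cls y)).1; lia.
pose U (A : {set V}) := [set x | (x \notin T) && (c x \in A)].
pose P A := #|X :|: U A| < k.
have P0 : P set0.
  by rewrite /P (_ : U set0 = set0) ?setU0 //; apply/setP => x; rewrite !inE andbF.
case: (@arg_maxnP _ set0 P (fun A => #|A|) P0) => A PA maxA.
(* [T] and [X :|: U A] each have fewer than [k] elements, while [V] has at least [2k]. *)
have [y yT yXU] : exists2 y, y \notin T & y \notin X :|: U A.
  have [|/subsetPn[y]] := boolP (~: T \subset X :|: U A); last first.
    by rewrite inE; exists y.
  by move=> /subset_leq_card; move: PA; rewrite /P; have := cardsC T; lia.
have yA : c y \notin A by move: yXU; rewrite !inE negb_or yT => /andP[].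
have : ~~ P (c y |: A) by apply/negP => /maxA; rewrite cardsU1 yA add1n /= ltnn.
rewrite /P -leqNgt => kA.
have [S [XUS SXU cS]] :
    exists S : {set V},
      [/\ X :|: U A \subset S, S \subset X :|: U (c y |: A) & #|S| = k].
  apply: intermediate_set; last by rewrite (ltnW PA).
  apply: setUS; apply/subsetP => x; rewrite !inE => /andP[-> ->].
  by rewrite orbT.
have : two_nbrs S :\: S \subset T :|: (cls y :\: X).
  apply/subsetP => v /setDP[vL vS]; rewrite in_setU; apply/orP.
  case: (boolP (v \in T)) => [|vT]; [by left | right].
  have vXU : v \notin X :|: U A by apply: contra vS; apply: (subsetP XUS).
  move: vXU; rewrite in_setU negb_or => /andP[vX]; rewrite inE vT /= => vA.
  rewrite in_setD vX inE vT /=; apply: contraLR vL => vy; apply: notL => //.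
    move=> u /(subsetP SXU); rewrite in_setU => /orP[/XP[] //|].
    by rewrite inE => /andP[].
  move=> u /(subsetP SXU); rewrite in_setU => /orP[//|].
  by rewrite !inE => /andP[_] + cuv; rewrite cuv (negPf vy) (negPf vA).
(* Now [k <= #|T| + #|cls y :\: X|], whereas [XC] gives [#|X| + #|cls y :\: X| < k], against
   [#|T| + 2 <= #|X|]. *)
move=> /subset_leq_card; have := expand_out cS; have := XC y yT.
have := (leq_card_setU T (cls y :\: X)).1; have := cardsUI X (cls y).
have := cardsD (cls y) X; rewrite (setIC (cls y)).
by have := subset_leq_card (subsetIr X (cls y)); lia.
Qed.

End Expansion.

(** * From involutions to sets of edges *)

Section EdgeSets.
Variable G : sgraph.
Implicit Types f g : {ffun G -> G}.

Definition edge_set f : {set {set G}} := [set [set x; f x] | x in ~: fixpts f].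

Lemma mem_edge_set f (A : {set G}) z :
  involutive f -> A \in edge_set f -> z \in A -> A = [set z; f z] /\ f z != z.
Proof.
move=> ff /imsetP[x]; rewrite !inE => fx ->; rewrite !inE => /orP[]/eqP -> //.
by rewrite ff setUC eq_sym.
Qed.

Lemma edge_set_neq0 f (A : {set G}) : A \in edge_set f -> exists z, z \in A.
Proof. by case/imsetP => x _ ->; exists x; rewrite !inE eqxx. Qed.

Lemma cover_edge_set f : involutive f -> cover (edge_set f) = ~: fixpts f.
Proof.
move=> ff; apply/setP => z; apply/bigcupP/idP => [[A Af zA]|zf].
  by have [_] := mem_edge_set ff Af zA; rewrite !inE.
by exists [set z; f z]; [apply: imset_f | rewrite !inE eqxx].
Qed.

Lemma edge_set_matching f : matching_off (@adj G) set0 f -> is_matching (edge_set f).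
Proof.
move=> /matching_offP[ff Hf]; apply/andP; split.
  apply/subsetP => A /imsetP[x]; rewrite !inE => /Hf[xfx _ _] ->.
  by apply/imsetP; exists (x, f x); rewrite ?inE.
apply/trivIsetP => A B Af Bf; apply: contraR => /pred0Pn[z /andP[/= zA zB]].
have [-> _] := mem_edge_set ff Af zA; have [-> _] := mem_edge_set ff Bf zB.
exact: eqxx.
Qed.

Lemma edge_set_disjoint f g : involutive f -> involutive g ->
  (forall x, f x = g x -> f x = x) -> [disjoint edge_set f & edge_set g].
Proof.
move=> ff gg fg; apply/pred0P => A /=; apply/negP => /andP[Af Ag].
have [z zA] := edge_set_neq0 Af.
have [A1 fz] := mem_edge_set ff Af zA; have [A2 gz] := mem_edge_set gg Ag zA.
have: f z \in A by rewrite A1 !inE eqxx orbT.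
by rewrite A2 !inE (negPf fz) /= => /eqP/fg/eqP; rewrite (negPf fz).
Qed.

End EdgeSets.

(** * Greedy removal of matchings *)

Section Greedy.
Variables (G : sgraph) (k : nat).
Hypotheses (k_gt0 : 0 < k) (kG : k <= #|G|)
  (expand : forall S : {set G}, admissible k S -> #|S| <= #|Lambda k S|).

Lemma greedy_matchings j : j < k -> exists F : nat -> {ffun G -> G},
  (forall i, i < j -> matching_off (@adj G) set0 (F i) /\ #|fixpts (F i)| <= 1) /\
  (forall i i' x, i < i' < j -> F i x = F i' x -> F i x = x).
Proof.
elim: j => [|j IH] jk.
  by exists (fun=> [ffun x => x]); split => // i i' x; rewrite ltn0 andbF.
have [F [mF dF]] := IH (ltnW jk).
pose H x y := adj x y && [forall i : 'I_j, F i x != y].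
have Hsym : symmetric H.
  move=> x y; rewrite /H adj_sym; congr (_ && _); apply: eq_forallb => i.
  have [/matching_offP[ff _] _] := mF i (ltn_ord i).
  by rewrite -(inj_eq (inv_inj ff)) ff eq_sym.
(* Each of the [j] earlier matchings removes at most one edge at [v], and [j + 2 <= k]. *)
have sL (S : {set G}) : Lambda k S \subset two_nbrs H S.
  apply/subsetP => v; rewrite !inE => kv.
  have sub : [set u in S | adj v u] \subset
      [set u in S | H v u] :|: [set F i v | i : 'I_j].
    apply/subsetP => u; rewrite !inE => /andP[-> vu]; rewrite /H vu /=.
    case: (boolP [forall _, _]) => //= /forallPn[i]; rewrite negbK => /eqP <-.
    exact: imset_f.
  have cI : #|[set F i v | i : 'I_j]| <= j.
    by rewrite -[X in _ <= X]card_ord; apply: leq_imset_card.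
  have := leq_trans kv (leq_trans (subset_leq_card sub) (leq_card_setU _ _).1).
  by move: cI jk; lia.
have d1 : deficit H set0 <= 1.
  apply: (@deficit_le1 _ H k) => // S.
    move=> kS LS; apply: leq_trans (subset_leq_card (sL S)).
    apply: expand; rewrite /admissible kS /=; apply: contra LS => /eqP LS.
    by have := sL S; rewrite LS subTset.
  move=> cS; have aS := admissible_card k_gt0 cS.
  rewrite -{1}cS; apply: leq_trans (expand aS) _; apply: subset_leq_card.
  rewrite subsetD sL /=; apply/pred0P => v /=; apply/negP => /andP[vL vS].
  move: vL; rewrite inE leqNgt => /negP; apply.
  rewrite -cS; apply: proper_card; apply/properP; split.
    by apply/subsetP => u; rewrite inE => /andP[].
  by exists v; rewrite // inE adj_irrefl andbF.
pose f := opt_matching H set0.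
have [ff Hf] := matching_offP _ _ _ (opt_matchingP H set0).
exists (fun i => if i == j then f else F i); split.
  move=> i; rewrite ltnS leq_eqVlt; case: eqVneq => [_ _|_ /=]; last exact: mF.
  split=> //; apply/matching_offP; split=> // x /Hf[/andP[xf _] _ _].
  by split; rewrite ?inE.
move=> i i' x /andP[ii' i'j].
have ij : i < j by lia.
rewrite (ltn_eqF ij); case: eqVneq => [_|ne]; last by apply: dF; lia.
move=> e; apply/eqP; rewrite e; apply/negPn/negP => /Hf[/andP[_ /forallP]].
by move=> /(_ (Ordinal ij)) /=; rewrite e eqxx.
Qed.

Lemma disjoint_matchings : exists F : {set {set {set G}}},
  [/\ #|F| = k - 1, edge_disjoint F &
      {in F, forall M, exists2 f : {ffun G -> G}, M = edge_set f &
         matching_off (@adj G) set0 f /\ #|fixpts f| <= 1}].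
Proof.
have k1 : k - 1 < k by lia.
have [F [mF dF]] := greedy_matchings k1.
pose M (i : 'I_(k - 1)) := edge_set (F i).
have disM i j : i != j -> [disjoint M i & M j].
  wlog lt_ij : i j / i < j.
    move=> W; rewrite -val_eqE neq_ltn => /orP[] h.
      by apply: W => //; rewrite -val_eqE /= ltn_eqF.
    by rewrite disjoint_sym; apply: W => //; rewrite -val_eqE /= ltn_eqF.
  move=> _; have [/matching_offP[fi _] _] := mF i (ltn_ord i).
  have [/matching_offP[fj _] _] := mF j (ltn_ord j).
  by apply: edge_set_disjoint => // x; apply: dF; rewrite lt_ij ltn_ord.
(* Equal matchings would be disjoint from themselves, hence empty, and would miss all of the at
   least [k >= 2] vertices; [k >= 2] because an index [i] exists. *)
have M_inj : injective M.
  move=> i j Mij; apply/eqP/negPn/negP => /disM; rewrite -Mij -setI_eq0 setIid.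
  have [mi ci] := mF i (ltn_ord i); have [ff _] := matching_offP _ _ _ mi.
  have := cover_edge_set ff; rewrite -/(M i) => cov /eqP M0.
  have := cardsC (fixpts (F i)); rewrite -cov M0 /cover big_set0 cards0.
  have k2 : 1 < k by have := ltn_ord i; lia.
  by lia.
exists [set M i | i : 'I_(k - 1)]; split.
- by rewrite card_imset // card_ord.
- move=> _ _ /imsetP[i _ ->] /imsetP[j _ ->] neq; apply: disM.
  by apply: contraNneq neq => ->.
- by move=> _ /imsetP[i _ ->]; exists (F i) => //; apply: mF.
Qed.

End Greedy.

(** * From [beta] to the expansion hypothesis, and the conclusion *)

Lemma beta_ge1_expand (G : sgraph) (k : nat) : 0 < k -> (1 <= beta G k)%R ->
  k <= #|G| /\ forall S : {set G}, admissible k S -> #|S| <= #|Lambda k S|.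
Proof.
move=> k0 b1; have kG : k <= #|G|.
  by rewrite leqNgt; apply/negP => /beta_lt b0; rewrite b0 in b1.
split=> // S aS; have [_ /(_ S aS) bS] := beta_min k0 kG.
have S0 : 0 < #|S| by case/andP: aS => /(leq_trans k0).
have := Order.POrderTheory.le_trans b1 bS; rewrite /ratio.
by rewrite Num.Theory.ler_pdivlMr ?Num.Theory.ltr0n // GRing.mul1r Num.Theory.ler_nat.
Qed.

Theorem theorem1p3 (k : nat) (hk : 1 <= k) (G : sgraph) (n : nat)
  (hn : #|G| = n) (hbeta : (1 <= beta G k)%R) :
  (~~ odd n ->
     exists F : {set {set {set G}}},
       [/\ k - 1 <= #|F|,
           {in F, forall M, perfect_matching M} &
           edge_disjoint F]) /\
  (odd n ->
     exists F : {set {set {set G}}},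
       [/\ k - 1 <= #|F|,
           {in F, forall M, near_perfect_matching M} &
           edge_disjoint F]).
Proof.
have [kG expand] := beta_ge1_expand hk hbeta.
have [F [cF dF mF]] := disjoint_matchings hk kG expand.
(* At most one vertex is uncovered, and the parity of [n] decides between none and one. *)
split=> n2; exists F; split; rewrite ?cF // => M /mF[f -> [mf f1]];
  have [ff _] := matching_offP _ _ _ mf; have := odd_card_fixpts ff;
  rewrite hn ?(negPf n2) ?n2 => of_; apply/andP; split;
  rewrite ?edge_set_matching // cover_edge_set //.
- rewrite (_ : fixpts f = set0) ?setC0 //; apply/eqP.
  by rewrite -cards_eq0; move: f1 of_; case: #|_| => [|[]].
- by rewrite setCK; move: f1 of_; case: #|_| => [|[]].
Qed.
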